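(* For any valid pair $(\mu,\nu)$, $\mathbf{P}(|S|=\infty)\in\{0,1\}$.
   Context: Bullet process. Let $\mu$ (velocity distribution) and $\nu$ (delay distribution) be probability measures on $(0,\infty)$, and let $(v_i,\Delta_i)_{i\ge 0}$ be i.i.d. with law $\mu\otimes\nu$. Bullet $b_i=(i,v_i,\Delta_i)$ has index $i$, velocity $v_i$ and delay $\Delta_i$. The bullet process on the sequence $(b_0,b_1,\dots)$ is defined as follows: $b_i$ is fired from the origin at time $t_i=\Delta_1+\cdots+\Delta_i$ (so $t_0=0$) and its trajectory is $d_t(i)=v_i(t-t_i)$ for $t\ge t_i$. It becomes active at time $t_i$ and remains active until the first time, if ever, it collides with (is at the same position as) another active bullet; colliding bullets annihilate and are inactive at all later times. A bullet survives if it is never annihilated. $S$ denotes the (random) set of bullets that survive in this process. The pair $(\mu,\nu)$ is valid if almost surely no three bullets collide simultaneously. This is assumed throughout. *)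

(* Defs.v *)
From HB Require Import structures.
From mathcomp Require Import all_boot all_order all_algebra.
From mathcomp Require Import finmap.
From mathcomp Require Import all_classical all_reals all_analysis.
From mathcomp Require Import lra.

Set Implicit Arguments.
Unset Strict Implicit.
Unset Printing Implicit Defensive.

Import Order.TTheory GRing.Theory Num.Theory.
Import numFieldNormedType.Exports.

Local Open Scope classical_set_scope.
Local Open Scope ring_scope.

(* A configuration is a deterministic sequence of pairs (velocity, delay). *)

Definition velocity (R : realType) (b : nat -> R * R) (i : nat) : R := (b i).1.

Definition delay (R : realType) (b : nat -> R * R) (i : nat) : R := (b i).2.

(* The delay of bullet 0 plays no role: fire_time b 0 = 0. *)
Definition fire_time (R : realType) (b : nat -> R * R) (i : nat) : R :=
  \sum_(1 <= k < i.+1) delay b k.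

(* Meaningful for t >= fire_time b i only. *)
Definition position (R : realType) (b : nat -> R * R) (i : nat) (t : R) : R :=
  velocity b i * (t - fire_time b i).

(* In the next two definitions [act i t] reads "bullet i is active at time t".
   Bullets are still active at the very instant of their collision, and
   inactive at all later times. *)
Definition collides (R : realType) (b : nat -> R * R)
    (act : nat -> R -> Prop) (i : nat) (t : R) : Prop :=
  exists j : nat, [/\ j <> i, act i t, act j t & position b i t = position b j t].

Definition bullet_process (R : realType) (b : nat -> R * R)
    (act : nat -> R -> Prop) : Prop :=
  forall (i : nat) (t : R),
    act i t <-> (fire_time b i <= t /\ forall s, s < t -> ~ collides b act i s).

(* The configurations for which [bullet_process] determines the evolution:
   only finitely many bullets are fired in bounded time.  Sequences that are
   i.i.d. with law supported by (0, +oo) x (0, +oo) are almost surely of this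
   form. *)
Definition well_posed (R : realType) (b : nat -> R * R) : Prop :=
  [/\ forall i, 0 < velocity b i, forall i, 0 < delay b i &
      fire_time b i @[i --> \oo] --> +oo].

(* On well-posed configurations this is the unique activity relation satisfying
   [bullet_process] (lemmas activeP and bullet_process_unique below); on the
   others, which form a null event, nothing is active by convention. *)
Definition active (R : realType) (b : nat -> R * R) (i : nat) (t : R) : Prop :=
  well_posed b /\ exists2 act, bullet_process b act & act i t.

Definition annihilated (R : realType) (b : nat -> R * R) (i : nat) : Prop :=
  exists t : R, collides b (active b) i t.

Definition survivors (R : realType) (b : nat -> R * R) : set nat :=
  [set i | ~ annihilated b i].

Definition triple_collision (R : realType) (b : nat -> R * R) : Prop :=
  exists (i j k : nat) (t : R),
    [/\ i <> j, j <> k & i <> k] /\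
    [/\ active b i t, active b j t & active b k t] /\
    position b i t = position b j t /\ position b j t = position b k t.

Definition independent_seq (d d' : measure_display) (T : measurableType d)
    (U : measurableType d') (R : realType) (P : probability T R)
    (X : nat -> {RV P >-> U}) : Prop :=
  forall (J : {fset nat}) (B : nat -> set U), (forall i, measurable (B i)) ->
    P (\bigcap_(i in [set` J]) (X i @^-1` B i)) =
    (\prod_(i <- J) P (X i @^-1` B i))%E.

Definition iid_bullets (R : realType) (mu nu : probability R R)
    (d : measure_display) (T : measurableType d) (P : probability T R)
    (b : nat -> {RV P >-> (R * R)%type}) : Prop :=
  independent_seq b /\
  forall (i : nat) (A : set (R * R)), measurable A ->
    distribution P (b i) A = (mu \x nu)%E A.

(* Being a property of the laws alone, validity is required of every
   realisation of the i.i.d. sequence. *)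
Definition valid_pair (R : realType) (mu nu : probability R R) : Prop :=
  forall (d : measure_display) (T : measurableType d) (P : probability T R)
    (b : nat -> {RV P >-> (R * R)%type}),
    iid_bullets mu nu b -> {ae P, forall w, ~ triple_collision (b ^~ w)}.

(* Existence and uniqueness of the bullet process on a well-posed
   configuration, by induction on the number of potential meeting times. *)

Section WellPosed.
Variables (R : realType) (b : nat -> R * R).

Fixpoint stage (n : nat) (i : nat) (t : R) : Prop :=
  if n is m.+1 then
    fire_time b i <= t /\ forall s, s < t -> ~ collides b (stage m) i s
  else fire_time b i <= t.

Lemma stage_fire n i t : stage n i t -> fire_time b i <= t.
Proof. by case: n => //= n []. Qed.

Lemma process_fire act i t :
  bullet_process b act -> act i t -> fire_time b i <= t.
Proof. by move=> H /H[]. Qed.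

Let meet (i j : nat) : R :=
  (velocity b i * fire_time b i - velocity b j * fire_time b j)
  / (velocity b i - velocity b j).

Let rank (N : nat) (t : R) : nat :=
  count (fun c => c < t) [seq meet i j | i <- iota 0 N, j <- iota 0 N].

Hypothesis wp : well_posed b.

Let fire_timeS i : fire_time b i < fire_time b i.+1.
Proof.
have [_ dpos _] := wp.
by rewrite /fire_time [ltRHS]big_nat_recr //= ltrDl dpos.
Qed.

Let fire_lt i j : (i < j)%N -> fire_time b i < fire_time b j.
Proof.
elim: j => // j IH; rewrite ltnS leq_eqVlt => /orP[/eqP ->|/IH ij] //.
exact: lt_trans ij _.
Qed.

Let fire_bounds N i t : t <= fire_time b N -> fire_time b i < t -> (i < N)%N.
Proof.
move=> tN it; rewrite ltnNge leq_eqVlt; apply/negP => /orP[/eqP Ni|/fire_lt Ni].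
  by move: (lt_le_trans it tN); rewrite Ni ltxx.
by move: (lt_trans (lt_le_trans it tN) Ni); rewrite ltxx.
Qed.

Let fire_inj i j : fire_time b i = fire_time b j -> i = j.
Proof.
move=> e; case: (ltngtP i j) => // /fire_lt; by rewrite e ltxx.
Qed.

Let rank_lt N i j s t : t <= fire_time b N -> s < t -> i <> j ->
  fire_time b i <= s -> fire_time b j <= s ->
  position b i s = position b j s -> (rank N s < rank N t)%N.
Proof.
move=> tN st ij is_ js eqp; have [vpos _ _] := wp.
have iN : (i < N)%N by apply: (fire_bounds tN); exact: le_lt_trans is_ st.
have jN : (j < N)%N by apply: (fire_bounds tN); exact: le_lt_trans js st.
have vij : velocity b i - velocity b j != 0.
  rewrite subr_eq0; apply/eqP => vij; apply: ij; apply: fire_inj.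
  move: eqp; rewrite /position vij => /mulfI.
  have /negbT -> : velocity b j == 0 = false by rewrite gt_eqF.
  by move=> /(_ isT) /addrI /oppr_inj.
have sE : s = meet i j.
  rewrite /meet; apply: (mulIf vij); rewrite mulfVK //.
  by move: eqp; rewrite /position; lra.
have sin : s \in [seq meet i j | i <- iota 0 N, j <- iota 0 N].
  by rewrite sE; apply: allpairs_f; rewrite mem_iota add0n leq0n.
rewrite /rank; move: sin; elim: [seq _ | _ <- _, _ <- _] => //= c l IH.
have mono : (count (fun c => (c < s)%R) l <= count (fun c => (c < t)%R) l)%N.
  by apply: sub_count => x /= xs; exact: lt_trans st.
rewrite in_cons => /orP[/eqP <-|/IH lt].
  by rewrite ltxx st add0n add1n ltnS.
rewrite -addnS leq_add //; case: (ltP c s) => //= cs.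
by rewrite (lt_trans cs st).
Qed.

Let stable (G H : nat -> nat -> R -> Prop) :
  (forall n i t, G n i t -> fire_time b i <= t) ->
  (forall n i t, H n i t -> fire_time b i <= t) ->
  (forall n i t, G n.+1 i t <->
     (fire_time b i <= t /\ forall s, s < t -> ~ collides b (G n) i s)) ->
  (forall n i t, H n.+1 i t <->
     (fire_time b i <= t /\ forall s, s < t -> ~ collides b (H n) i s)) ->
  forall N k n m i t, (rank N t < k)%N -> t <= fire_time b N ->
    (rank N t < n)%N -> (rank N t < m)%N -> (G n i t <-> H m i t).
Proof.
move=> G0 H0 GS HS N; elim=> // k IH [|n] [|m] i t // rk tN rn rm.
have aux s : s < t -> collides b (G n) i s <-> collides b (H m) i s.
  move=> st; have E j1 j2 : j1 <> j2 -> fire_time b j1 <= s ->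
      fire_time b j2 <= s -> position b j1 s = position b j2 s ->
      forall j, G n j s <-> H m j s.
    move=> j12 f1 f2 e j; have r := rank_lt tN st j12 f1 f2 e.
    apply: IH; [exact: leq_trans r _|exact: le_trans (ltW st) tN| |];
      exact: leq_trans r _.
  split=> -[j [ji ai aj e]]; exists j; split=> //.
  - by apply/(E _ _ ji (G0 _ _ _ aj) (G0 _ _ _ ai) (esym e)).
  - by apply/(E _ _ ji (G0 _ _ _ aj) (G0 _ _ _ ai) (esym e)).
  - by apply/(E _ _ ji (H0 _ _ _ aj) (H0 _ _ _ ai) (esym e)).
  - by apply/(E _ _ ji (H0 _ _ _ aj) (H0 _ _ _ ai) (esym e)).
rewrite GS HS; split=> -[it nc]; split=> // s st /(aux _ st); exact: nc.
Qed.

Let horizon t : exists N, t <= fire_time b N.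
Proof.
have [_ _ /cvgryPge /(_ t)] := wp.
by case=> N _ /(_ N (leqnn N)) tN; exists N.
Qed.

Lemma bullet_process_unique act act' : bullet_process b act ->
  bullet_process b act' -> forall i t, act i t <-> act' i t.
Proof.
move=> H H' i t; have [N tN] := horizon t.
apply: (@stable (fun=> act) (fun=> act') _ _ _ _ N _ _ _ i t
  (ltnSn _) tN (ltnSn _) (ltnSn _)) => // _ j s; first exact: process_fire.
exact: process_fire.
Qed.

Lemma bullet_process_exists : exists act, bullet_process b act.
Proof.
have st := @stable stage stage stage_fire stage_fire
  (fun _ _ _ => iff_refl _) (fun _ _ _ => iff_refl _).
pose N t := projT1 (cid (horizon t)).
have NP t : t <= fire_time b (N t) := projT2 (cid (horizon t)).
pose act i t := stage (rank (N t) t).+1 i t.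
exists act => i t.
have actE j s n : s <= t -> (rank (N t) s < n)%N -> (act j s <-> stage n j s).
  move=> le_st rn; pose M := maxn n (maxn (rank (N t) s) (rank (N s) s)).+1.
  have M1 : (rank (N t) s < M)%N by rewrite leq_max ltnS leq_max leqnn orbT.
  have M2 : (rank (N s) s < M)%N by rewrite leq_max ltnS leq_max leqnn !orbT.
  apply: (iff_trans (B := stage M j s)).
    exact: (st (N s) _ _ _ _ _ (ltnSn _) (NP s)).
  exact: (st (N t) _ _ _ _ _ (ltnSn _) (le_trans le_st (NP t))).
rewrite /act /=.
have aux s : s < t ->
    collides b (stage (rank (N t) t)) i s <-> collides b act i s.
  move=> lst; have E j1 j2 : j1 <> j2 -> fire_time b j1 <= s ->
      fire_time b j2 <= s -> position b j1 s = position b j2 s ->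
      forall j, act j s <-> stage (rank (N t) t) j s.
    move=> j12 f1 f2 e j; apply: (actE _ _ _ (ltW lst)).
    exact: rank_lt (NP t) lst j12 f1 f2 e.
  split=> -[j [ji ai aj e]]; exists j; split=> //;
    by apply/(E _ _ ji (stage_fire aj) (stage_fire ai) (esym e)).
split=> -[it nc]; split=> // s lst /(aux _ lst); exact: nc.
Qed.

Lemma activeP : bullet_process b (active b).
Proof.
have [act H] := bullet_process_exists.
have E : active b = act.
  apply/funext => i; apply/funext => t; apply/propext; split.
    by case=> _ [act' H' /(bullet_process_unique H' H)].
  by move=> ait; split => //; exists act.
by rewrite E.
Qed.

End WellPosed.

(* Main.v *)
Require Import Defs.
From HB Require Import structures.
From mathcomp Require Import all_boot all_order all_algebra.
From mathcomp Require Import finmap.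
From mathcomp Require Import all_classical all_reals all_analysis.
From mathcomp Require Import measurable_realfun lra.

(** Whether infinitely many bullets survive does not depend on the first bullet.
    Compare the process on all bullets with the process on the bullets of index
    at least 1, run on the same clock.  At any time, at most one bullet is active
    in one process and not in the other ([discrepancy_unique]): the discrepancy
    starts with bullet 0; when the bullet x that carries it hits a bullet y in
    its process, y is left alive in the other process only, and becomes the new
    carrier.  There is no other way for the discrepancy to move, unless three
    bullets collide simultaneously, which validity excludes almost surely for
    both processes.  Hence the two sets of survivors differ by at most one
    bullet, and both are infinite or both are finite
    ([infinite_survivors_drop_first]).

    By induction, the event E that infinitely many bullets survive is almost
    surely equal, for every n, to the same event for the bullets of index at
    least n, which depends on those bullets only.  So E is independent of any
    finite number of bullets, hence of itself, and its probability p satisfies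
    p = p * p ([zero_one_law]).

    The measurability of E ([measurable_infinite_survivors]) rests on the
    observation that a collision of i and j can only occur at an explicit
    measurable time, and that activity at a random time is the limit of
    approximations that are defined from finitely many generations of such
    collisions ([stage_active]). *)

Import Order.TTheory GRing.Theory Num.Theory.
Import numFieldNormedType.Exports.

Local Open Scope classical_set_scope.
Local Open Scope ring_scope.

Set Implicit Arguments.
Unset Strict Implicit.
Unset Printing Implicit Defensive.

(** * Meeting times *)

Section Meetings.
Context {R : realType}.
Variable b : nat -> R * R.

Definition meet_time (i j : nat) : R :=
  (velocity b i * fire_time b i - velocity b j * fire_time b j)
  / (velocity b i - velocity b j).

(** The trajectories cross at time s, whether or not the bullets are still
    there: unlike collisions, meetings do not depend on the evolution. *)
Definition meeting (s : R) : Prop := exists i j : nat,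
  [/\ i <> j, fire_time b i <= s, fire_time b j <= s &
      position b i s = position b j s].

Lemma meet_timeP i j s : velocity b i != velocity b j ->
  position b i s = position b j s <-> s = meet_time i j.
Proof.
rewrite -subr_eq0 => vij; rewrite /meet_time; split=> [e|->].
  by apply: (mulIf vij); rewrite mulfVK //; move: e; rewrite /position; lra.
set s' := _ / _.
have e : s' * (velocity b i - velocity b j) =
    velocity b i * fire_time b i - velocity b j * fire_time b j.
  by rewrite /s' mulfVK.
by move: e; rewrite /position; lra.
Qed.

Lemma fire_time0 : fire_time b 0 = 0.
Proof. by rewrite /fire_time big_geq. Qed.

Lemma fire_timeS i : fire_time b i.+1 = fire_time b i + delay b i.+1.
Proof. by rewrite /fire_time big_nat_recr. Qed.

Hypothesis wp : well_posed b.

Lemma fire_time_lt : {homo fire_time b : i j / (i < j)%N >-> i < j}.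
Proof.
move=> i j; have [_ dpos _] := wp.
elim: j => // j IH; rewrite ltnS leq_eqVlt fire_timeS => /orP[/eqP ->|/IH ij].
  by rewrite ltrDl.
by apply: lt_trans ij _; rewrite ltrDl.
Qed.

Lemma fire_time_ge0 i : 0 <= fire_time b i.
Proof. by rewrite -fire_time0; case: i => // i; apply/ltW/fire_time_lt. Qed.

Lemma fire_time_inj : injective (fire_time b).
Proof.
by move=> i j e; case: (ltngtP i j) => // /fire_time_lt; rewrite e ltxx.
Qed.

Lemma meet_velocity i j s : i <> j -> position b i s = position b j s ->
  velocity b i != velocity b j.
Proof.
move=> ij; have [vpos _ _] := wp; apply: contra_eqN => /eqP vij.
rewrite /position vij; apply/eqP => /mulfI; rewrite gt_eqF // => /(_ isT).
by move=> /addrI /oppr_inj /fire_time_inj.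
Qed.

(** Only the finitely many bullets fired before t can meet before t, and two
    of them meet at most once, since equal velocities would force equal firing
    times. *)
Lemma finite_meetings t : finite_set [set s | s < t /\ meeting s].
Proof.
have [_ _ /cvgryPge /(_ t)] := wp; case=> N _ /(_ N (leqnn N)) /= tN.
have lt_N i s : s < t -> fire_time b i <= s -> (i < N)%N.
  move=> st is_; rewrite ltnNge leq_eqVlt; apply/negP.
  move=> /orP[/eqP Ni|/fire_time_lt Ni].
    by move: (le_lt_trans is_ (lt_le_trans st tN)); rewrite Ni ltxx.
  by move: (lt_trans Ni (le_lt_trans is_ (lt_le_trans st tN))); rewrite ltxx.
apply: (@sub_finite_set _ _
  ((fun p => meet_time p.1 p.2) @` (`I_N `*` `I_N))); last first.
  by apply: finite_image; apply: finite_setX; exact: finite_II.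
move=> s /= [st [i [j [ij is_ js e]]]]; exists (i, j) => /=.
  by split; apply: (lt_N _ s).
by apply/esym/meet_timeP => //; exact: meet_velocity ij e.
Qed.

Definition rank (t : R) : nat := #|` fset_set [set s | s < t /\ meeting s]|.

Lemma rank_lt s t : s < t -> meeting s -> (rank s < rank t)%N.
Proof.
move=> st ms; apply: fproper_ltn_card; rewrite fproperEneq; apply/andP; split.
  apply/eqP => /fset_set_inj e.
  have : [set r | r < s /\ meeting r] s.
    by rewrite e; [split|exact: finite_meetings|exact: finite_meetings].
  by case; rewrite ltxx.
rewrite -fset_set_sub; [|exact: finite_meetings|exact: finite_meetings].
by move=> r /= [rs mr]; split=> //; exact: lt_trans st.
Qed.

(** Collisions are meetings, so the state at time t depends only on the states
    at earlier meeting times.  As these are finitely many, this is a substitute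
    for induction on the collisions in chronological order. *)
Lemma meeting_ind (Q : R -> Prop) :
  (forall t, (forall s, s < t -> meeting s -> Q s) -> Q t) -> forall t, Q t.
Proof.
move=> H t; have [k] := ubnP (rank t); elim: k t => // k IH t tk.
by apply: H => s st ms; apply: IH; exact: leq_trans (rank_lt st ms) tk.
Qed.

(** The approximations [stage b n] are eventually constant at each fixed time;
    this turns activity into a countable combination of measurable
    conditions. *)
Lemma stage_active t n i : (rank t < n)%N -> stage b n i t <-> active b i t.
Proof.
elim/meeting_ind: t n i => t IH [//|n] i tn /=.
have aux s : s < t -> collides b (stage b n) i s <-> collides b (active b) i s.
  move=> st; split=> -[j [ji ai aj e]].
  - have ms : meeting s.
      by exists j, i; split=> //; apply: stage_fire; [exact: aj|exact: ai].
    have sn : (rank s < n)%N by exact: leq_trans (rank_lt st ms) _.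
    by exists j; split=> //; apply/(IH _ st ms n).
  - have ms : meeting s.
      by exists j, i; split=> //; apply: (process_fire (activeP wp)).
    have sn : (rank s < n)%N by exact: leq_trans (rank_lt st ms) _.
    by exists j; split=> //; apply/(IH _ st ms n).
rewrite (activeP wp i t); split=> -[it nc]; split=> // s st /(aux s st);
  exact: nc.
Qed.

End Meetings.

(** * Two processes that differ by one bullet *)

Section RestrictedProcess.
Context {R : realType}.
Variable b : nat -> R * R.

(** Restricting the labels, instead of renumbering, lets the process without
    bullet 0 run on the same clock and with the same labels as the full one. *)
Definition process_on (J : nat -> Prop) (act : nat -> R -> Prop) : Prop :=
  forall i t, act i t <->
    [/\ J i, fire_time b i <= t & forall s, s < t -> ~ collides b act i s].

Definition no_triple (act : nat -> R -> Prop) : Prop :=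
  forall i j k t, i <> j -> j <> k -> i <> k ->
    act i t -> act j t -> act k t ->
    position b i t = position b j t -> position b j t = position b k t -> False.

Definition survivors_on (J : nat -> Prop) (act : nat -> R -> Prop) : set nat :=
  [set i | J i /\ forall t, ~ collides b act i t].

Definition discrepancy (X Y : nat -> R -> Prop) (t : R) : set nat :=
  [set i | (X i t /\ ~ Y i t) \/ (Y i t /\ ~ X i t)].

Lemma discrepancyC X Y t : discrepancy X Y t = discrepancy Y X t.
Proof. by apply/seteqP; split=> i [] h; [right|left|right|left]. Qed.

Lemma process_mono J X i s t : process_on J X ->
  X i t -> fire_time b i <= s -> s <= t -> X i s.
Proof.
move=> HX /HX[Ji _ nc] is_ st; apply/HX; split=> // r rs.
exact: nc (lt_le_trans rs st).
Qed.

Lemma process_nocollide J X i s t : process_on J X ->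
  X i t -> s < t -> ~ collides b X i s.
Proof. by move=> HX /HX[_ _ nc] st; exact: nc. Qed.

Lemma process_on_fire J X i t : process_on J X -> X i t -> fire_time b i <= t.
Proof. by move=> HX /HX[]. Qed.

(** Why a bullet i is active at time t in X only.  Either it is bullet 0,
    which Y may lack; or Y annihilated it at some time s, by a collision
    with a bullet k that X had already lost.  In the second case the discrepancy
    is handed over from k to i at time s: k belongs to it at s, and is dead in
    both processes afterwards. *)
Lemma discrepancy_origin J J' X Y i t : process_on J X -> process_on J' Y ->
  (forall j, J j.+1 <-> J' j.+1) -> X i t -> ~ Y i t ->
  (i = 0%N /\ forall r, fire_time b i <= r -> r <= t -> discrepancy X Y r i) \/
  exists s k, [/\ s < t /\ meeting b s,
    forall r, s < r -> r <= t -> discrepancy X Y r i,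
    X i s /\ Y i s,
    i <> k /\ position b i s = position b k s &
    ~ X k s /\ Y k s /\ ~ discrepancy X Y t k].
Proof.
move=> HX HY JJ Xi nYi; have /HX[Ji it _] := Xi.
have [Ji'|nJi] := pselect (J' i); last first.
  left; split; first by case: i Ji nJi {Xi nYi it} => // i /JJ.
  move=> r ir rt; left; split; first exact: process_mono Xi ir rt.
  by move=> /HY[].
have [s [st cs]] : exists s, s < t /\ collides b Y i s.
  apply: contra_notP nYi => /forallNP nc; apply/HY; split=> // s st cs.
  by apply: (nc s).
right; have [k [ki Yi Yk e]] := cs; exists s, k.
have is_ := process_on_fire HY Yi; have ks := process_on_fire HY Yk.
have Xis : X i s by exact: process_mono Xi is_ (ltW st).
have nXk : ~ X k s.
  by move=> Xk; apply: (process_nocollide HX Xi st); exists k; split.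
split=> //.
- by split=> //; exists i, k; split=> //; exact/nesym.
- move=> r sr rt; left; split.
    by apply: process_mono Xi _ rt => //; exact: le_trans is_ (ltW sr).
  by move=> Yir; apply: (process_nocollide HY Yir sr).
- by split=> //; exact/nesym.
- split=> //; split=> // -[[Xkt _]|[Ykt _]].
    by apply: nXk; exact: process_mono Xkt ks (ltW st).
  apply: (process_nocollide HY Ykt st).
  by exists i; split=> //; exact/nesym.
Qed.

(** The discrepancy is carried by one bullet at a time.  If two bullets i and j
    carried it at time t, compare the times at which they received it.  If i
    received it strictly before j, then i and the predecessor k of j both
    carried it when j received it, so i = k by induction, although k is dead by
    time t; bullet 0 counts as having always carried what it was not handed.
    If they received it simultaneously, they received it from the same
    k by induction, and i, j, k collided together in the process where k was
    alive. *)
Lemma discrepancy_unique J J' X Y : well_posed b ->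
  process_on J X -> process_on J' Y -> (forall j, J j.+1 <-> J' j.+1) ->
  no_triple X -> no_triple Y ->
  forall t i j, discrepancy X Y t i -> discrepancy X Y t j -> i = j.
Proof.
move=> wp HX HY JJ tX tY t; elim/(meeting_ind wp): t => t IH i j.
pose O i := (i = 0%N /\
    forall r, fire_time b i <= r -> r <= t -> discrepancy X Y r i) \/
  exists s k, [/\ s < t /\ meeting b s,
    forall r, s < r -> r <= t -> discrepancy X Y r i,
    discrepancy X Y s k, ~ discrepancy X Y t k &
    ((X i s /\ X k s) \/ (Y i s /\ Y k s)) /\ i <> k /\
    position b i s = position b k s].
have HO l : discrepancy X Y t l -> O l.
  case=> [] [].
    move=> Xl nYl; have [?|] := discrepancy_origin HX HY JJ Xl nYl.
      by left.
    case=> s [k [h1 h2 [Xls Yls] [lk e] [nXk [Yk h]]]]; right; exists s, k.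
    split=> //; first by right.
    by split; first by right.
  move=> Yl nXl; have JJ' n : J' n.+1 <-> J n.+1 by rewrite JJ.
  have [[l0 h]|] := discrepancy_origin HY HX JJ' Yl nXl.
    by left; split=> // r ? ?; rewrite discrepancyC; exact: h.
  case=> s [k [h1 h2 [Yls Xls] [lk e] [nYk [Xk h]]]]; right; exists s, k.
  split=> //; [|by left| |].
  - by move=> r sr rt; rewrite discrepancyC; exact: h2.
  - by rewrite discrepancyC.
  - by split; first by left.
have disj k s : discrepancy X Y s k -> X k s -> Y k s -> False.
  by move=> [] [].
have fire0 s : meeting b s -> fire_time b 0 <= s.
  move=> [l [_ [_ ls _ _]]]; rewrite fire_time0.
  exact: le_trans (fire_time_ge0 wp l) ls.
have mixed s1 s2 k2 i' : s1 < s2 -> s2 < t -> meeting b s2 ->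
    (forall r, s1 < r -> r <= t -> discrepancy X Y r i') ->
    discrepancy X Y t i' ->
    discrepancy X Y s2 k2 -> ~ discrepancy X Y t k2 -> False.
  move=> s12 st ms hi di dk; apply.
  by rewrite -(IH _ st ms _ _ (hi _ s12 (ltW st)) dk).
move=> di dj; apply: contrapT => ij.
have [[i0 hi]|[s1 [k1 [[st1 m1] hi dk1 nk1 [a1 [ik e1]]]]]] := HO _ di;
  have [[j0 hj]|[s2 [k2 [[st2 m2] hj dk2 nk2 [a2 [jk e2]]]]]] := HO _ dj.
- by apply: ij; rewrite i0 j0.
- apply: nk2; rewrite -(IH _ st2 m2 i k2) //; apply: hi (ltW st2).
  by rewrite i0; exact: fire0.
- apply: nk1; rewrite -(IH _ st1 m1 j k1) //; apply: hj (ltW st1).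
  by rewrite j0; exact: fire0.
- have [s12|s21|s12] := ltgtP s1 s2.
  + exact: (mixed s1 s2 k2 i s12 st2).
  + exact: (mixed s2 s1 k1 j s21 st1).
  + subst s2; have k12 := IH _ st1 m1 _ _ dk1 dk2; subst k2.
    have ejk := esym e2; case: a1 => [] [ai ak]; case: a2 => [] [aj ak'].
    * by apply: (tX i k1 j s1) => //; exact/nesym.
    * exact: disj dk1 ak ak'.
    * exact: disj dk1 ak' ak.
    * by apply: (tY i k1 j s1) => //; exact/nesym.
Qed.

Lemma survivors_on_late J X i : process_on J X ->
  exists t, forall r, t <= r -> survivors_on J X i <-> X i r.
Proof.
move=> HX; have [Si|nSi] := pselect (survivors_on J X i).
  exists (fire_time b i) => r ir; split=> // _; apply/HX.
  by case: Si => Ji nc; split=> // s _.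
suff [s hs] : exists s, forall r, s < r -> ~ X i r.
  exists (s + 1) => r sr; split=> // Xr; case: (hs r) => //.
  by apply: lt_le_trans sr; rewrite ltrDl.
have [Ji|nJi] := pselect (J i); last by exists 0 => r _ Xr; case/HX: (Xr).
have [s cs] : exists s, collides b X i s.
  by apply: contra_notP nSi => /forallNP.
by exists s => r sr Xr; exact: process_nocollide HX Xr sr cs.
Qed.

(** Two bullets that survive in X only would both belong to the discrepancy at
    a late enough time, so there is at most one such bullet. *)
Lemma infinite_survivors_on J J' X Y : well_posed b ->
  process_on J X -> process_on J' Y -> (forall j, J j.+1 <-> J' j.+1) ->
  no_triple X -> no_triple Y ->
  infinite_set (survivors_on J X) -> infinite_set (survivors_on J' Y).
Proof.
move=> wp HX HY JJ tX tY infX finY.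
have : infinite_set (survivors_on J X `\` survivors_on J' Y).
  by apply: infinite_setD.
apply; set D := (X in finite_set X).
have Duniq i j : D i -> D j -> i = j.
  move=> [Xi Yi] [Xj Yj].
  have [ti hi] := survivors_on_late i HX.
  have [ti' hi'] := survivors_on_late i HY.
  have [tj hj] := survivors_on_late j HX.
  have [tj' hj'] := survivors_on_late j HY.
  pose t := Num.max (Num.max ti ti') (Num.max tj tj').
  apply: (discrepancy_unique wp HX HY JJ tX tY (t := t)); left.
    split; first by apply/hi => //; rewrite /t !le_max lexx.
    by move/hi'; apply/not_implyP; split=> //; rewrite /t !le_max lexx orbT.
  split; first by apply/hj => //; rewrite /t !le_max lexx !orbT.
  by move/hj'; apply/not_implyP; split=> //; rewrite /t !le_max lexx !orbT.
have [[i Di]|nD] := pselect (exists i, D i).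
  by apply: (@sub_finite_set _ _ [set i]) => // j Dj; exact: Duniq.
by apply: (@sub_finite_set _ _ set0) => // j Dj; apply: nD; exists j.
Qed.

End RestrictedProcess.

(** * Removing the first bullet *)

Section DropFirst.
Context {R : realType}.
Implicit Types b : nat -> R * R.

Definition drop_first b : nat -> R * R := fun i => b i.+1.

Lemma fire_time_drop_first b i :
  fire_time b i.+1 = delay b 1 + fire_time (drop_first b) i.
Proof.
elim: i => [|i IH]; first by rewrite fire_timeS !fire_time0 addrC.
by rewrite fire_timeS IH [in RHS]fire_timeS addrA.
Qed.

Lemma position_drop_first b i t :
  position b i.+1 t = position (drop_first b) i (t - delay b 1).
Proof. by rewrite /position fire_time_drop_first opprD addrA. Qed.

Lemma well_posed_drop_first b : 0 < velocity b 0 -> 0 < delay b 0 ->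
  well_posed (drop_first b) <-> well_posed b.
Proof.
move=> v0 d0.
have cvgE : (fire_time (drop_first b) i @[i --> \oo] --> +oo) <->
            (fire_time b i @[i --> \oo] --> +oo).
  rewrite -(cvg_shiftS (fire_time b)).
  split=> /cvgryPge h; apply/cvgryPge => A.
    near=> i; rewrite /= fire_time_drop_first -lerBlDl; near: i; exact: h.
  near=> i; rewrite -(lerD2l (delay b 1)) -fire_time_drop_first; near: i; exact: h.
split=> -[hv hd hc].
  by split; [case=> [|i] //; exact: hv|case=> [|i] //; exact: hd|exact/cvgE].
by split; [move=> i; exact: hv|move=> i; exact: hd|exact/cvgE].
Unshelve. all: by end_near. Qed.

(** The process on the configuration without bullet 0, seen with the labels and
    the clock of the full configuration: its origin of time is the firing time
    [delay b 1] of bullet 1. *)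
Definition unshift_active b (i : nat) (t : R) : Prop :=
  if i is j.+1 then active (drop_first b) j (t - delay b 1) else False.

Lemma active_process_on b : well_posed b -> process_on b xpredT (active b).
Proof.
by move=> wp i t; rewrite (activeP wp i t); split=> [[]|[]].
Qed.

Lemma collides_unshift b i t :
  collides b (unshift_active b) i.+1 t <->
  collides (drop_first b) (active (drop_first b)) i (t - delay b 1).
Proof.
split=> -[]; last first.
  move=> j [ji ai aj e]; exists j.+1; split=> //; first by case.
  by rewrite !position_drop_first.
case=> [|j] [ji ai aj e] //; exists j; split=> //.
  by move=> ji'; apply: ji; rewrite ji'.
by rewrite -!position_drop_first.
Qed.

Lemma unshift_process_on b : well_posed (drop_first b) ->
  process_on b (fun i => (0 < i)%N) (unshift_active b).
Proof.
move=> wp [|i] t /=; first by split=> // -[].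
rewrite (activeP wp i (t - delay b 1)) fire_time_drop_first -lerBrDl.
split=> [[it nc]|[_ it nc]]; split=> // s st.
  by move=> /collides_unshift; apply: nc; rewrite ltrD2r.
rewrite -[s](addrK (delay b 1)) => /collides_unshift; apply: nc.
by rewrite -ltrBrDr.
Qed.

Lemma survivors_process_on b :
  survivors b = survivors_on b xpredT (active b).
Proof.
apply/seteqP; split=> i /=; first by move=> /forallNP.
by move=> [_ nc] [t]; exact: nc.
Qed.

Lemma survivors_unshift b :
  survivors_on b (fun i => (0 < i)%N) (unshift_active b) =
  succn @` survivors (drop_first b).
Proof.
apply/seteqP; split=> [[|i]|_ [i Si <-]]; first by move=> [].
  move=> [_ nc]; exists i => // -[t]; rewrite -[t](addrK (delay b 1)).
  by move=> /collides_unshift; exact: nc.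
by split=> // t /collides_unshift c; apply: Si; exists (t - delay b 1).
Qed.

Lemma no_tripleP b : ~ triple_collision b -> no_triple b (active b).
Proof.
move=> nt i j k t ij jk ik ai aj ak e1 e2; apply: nt.
by exists i, j, k, t; split.
Qed.

Lemma no_triple_unshift b : ~ triple_collision (drop_first b) ->
  no_triple b (unshift_active b).
Proof.
move=> /no_tripleP nt [|i] [|j] [|k] t //= ij jk ik ai aj ak.
rewrite !position_drop_first; apply: nt ai aj ak => //.
- by move=> e; apply: ij; rewrite e.
- by move=> e; apply: jk; rewrite e.
- by move=> e; apply: ik; rewrite e.
Qed.

Lemma survivors_ill_posed b : ~ well_posed b -> survivors b = setT.
Proof. by move=> nwp; apply/seteqP; split=> i // _ [t [j [_ [/nwp]]]]. Qed.

(** Ill-posed configurations need no almost sure argument: b and [drop_first b]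
    are ill-posed together, and then by convention nothing is ever active, so
    every bullet survives in both. *)
Lemma infinite_survivors_drop_first b : 0 < velocity b 0 -> 0 < delay b 0 ->
  ~ triple_collision b -> ~ triple_collision (drop_first b) ->
  infinite_set (survivors b) <-> infinite_set (survivors (drop_first b)).
Proof.
move=> v0 d0 nt nt'.
have [wp|nwp] := pselect (well_posed b); last first.
  rewrite !survivors_ill_posed //.
  by move/(well_posed_drop_first v0 d0).
have wp' : well_posed (drop_first b) by apply/(well_posed_drop_first v0 d0).
have -> : infinite_set (survivors (drop_first b)) <->
    infinite_set (succn @` survivors (drop_first b)).
  split; apply: contra_not => fin; last exact: finite_image.
  apply: (@sub_finite_set _ _ (predn @` (succn @` survivors (drop_first b)))).
    by move=> i Si; exists i.+1 => //; exists i.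
  exact: finite_image.
rewrite -survivors_unshift survivors_process_on.
have HX := active_process_on wp; have HY := unshift_process_on wp'.
have tX := no_tripleP nt; have tY := no_triple_unshift nt'.
split; first exact: (infinite_survivors_on wp HX HY).
exact: (infinite_survivors_on wp HY HX).
Qed.

End DropFirst.

(** * Measurability of the event *)

Section MeasurablePredicates.
Context d (T : measurableType d) (R : realType).
Implicit Types p q : T -> Prop.

Definition mpred p := measurable [set w | p w].

Lemma mpredN p : mpred p -> mpred (fun w => ~ p w).
Proof. exact: measurableC. Qed.

Lemma mpred_and p q : mpred p -> mpred q -> mpred (fun w => p w /\ q w).
Proof. exact: measurableI. Qed.

Lemma mpred_forall (I : countType) (p : I -> T -> Prop) :
  (forall i, mpred (p i)) -> mpred (fun w => forall i, p i w).
Proof.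
move=> mp; rewrite /mpred (_ : [set _ | _] = \bigcap_i [set w | p i w]).
  rewrite -[X in measurable X]setCK setC_bigcap; apply: measurableC.
  by apply: countable_bigcupT_measurable => // i; apply: measurableC; exact: mp.
by apply/seteqP; split=> w /= h i; [move=> _|]; exact: h.
Qed.

Lemma mpred_exists (I : countType) (p : I -> T -> Prop) :
  (forall i, mpred (p i)) -> mpred (fun w => exists i, p i w).
Proof.
move=> mp; rewrite /mpred (_ : [set _ | _] = \bigcup_i [set w | p i w]).
  by apply: countable_bigcupT_measurable => // i; exact: mp.
by apply/seteqP; split=> w /= [i]; [exists i|move=> _; exists i].
Qed.

Lemma mpred_iff p q : (forall w, p w <-> q w) -> mpred p -> mpred q.
Proof.
by move=> pq; rewrite /mpred (_ : mkset p = mkset q) //; apply/funext=> w; apply/propext.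
Qed.

Lemma mpred_const (A : Prop) : mpred (fun=> A).
Proof.
have [a|na] := pselect A.
  by apply: (@mpred_iff (fun=> True)) => //; exact: measurableT.
by apply: (@mpred_iff (fun=> False)) => //; exact: measurable0.
Qed.

Lemma mpred_imp (A : Prop) p : (A -> mpred p) -> mpred (fun w => A -> p w).
Proof.
have [a /(_ a)|na _] := pselect A.
  by apply: mpred_iff => w; split=> // /(_ a).
by apply: (@mpred_iff (fun=> True)) => //; exact: measurableT.
Qed.

Lemma mpred_lt (f g : T -> R) : measurable_fun setT f -> measurable_fun setT g ->
  mpred (fun w => f w < g w).
Proof.
by move=> mf mg; rewrite /mpred -[X in measurable X]setTI; exact: measurable_fun_ltr.
Qed.

Lemma mpred_le (f g : T -> R) : measurable_fun setT f -> measurable_fun setT g ->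
  mpred (fun w => f w <= g w).
Proof.
by move=> mf mg; rewrite /mpred -[X in measurable X]setTI; exact: measurable_fun_ler.
Qed.

Lemma mpred_neq (f g : T -> R) : measurable_fun setT f -> measurable_fun setT g ->
  mpred (fun w => f w != g w).
Proof.
move=> mf mg; apply: (@mpred_iff (fun w => ~ (f w == g w))).
  by move=> w; split=> [/negP|/negP].
by apply: mpredN; rewrite /mpred -[X in measurable X]setTI; exact: measurable_fun_eqr.
Qed.

End MeasurablePredicates.

(** A power function is measurable for every exponent, but agrees with a real
    inverse on nonnegative arguments only, hence the detour by squares. *)
Lemma measurable_invr (R : realType) : measurable_fun [set: R] (@GRing.inv R).
Proof.
rewrite (_ : GRing.inv = fun x : R => x * (x ^+ 2) `^ (-1)).
  apply: measurable_funM => //.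
  apply: (measurableT_comp (measurable_powR _)).
  exact: exprn_measurable.
apply/funext => x; have [->|x0] := eqVneq x 0; first by rewrite invr0 mul0r.
by rewrite powR_inv1 ?sqr_ge0 // expr2 invfM mulrA divff ?mul1r.
Qed.

Section Measurability.
Context d (T : measurableType d) (R : realType).
Variable b : nat -> T -> R * R.
Hypothesis mb : forall i, measurable_fun setT (b i).

Lemma measurable_velocity i : measurable_fun setT (fun w => velocity (b ^~ w) i).
Proof. exact: measurableT_comp measurable_fst (mb i). Qed.

Lemma measurable_delay i : measurable_fun setT (fun w => delay (b ^~ w) i).
Proof. exact: measurableT_comp measurable_snd (mb i). Qed.

Lemma measurable_fire_time i : measurable_fun setT (fun w => fire_time (b ^~ w) i).
Proof. by apply: measurable_sum => k; exact: measurable_delay. Qed.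

Lemma measurable_meet_time i j :
  measurable_fun setT (fun w => meet_time (b ^~ w) i j).
Proof.
apply: measurable_funM.
  by apply: measurable_funB; apply: measurable_funM;
    solve [exact: measurable_velocity|exact: measurable_fire_time].
apply: measurableT_comp; first exact: measurable_invr.
by apply: measurable_funB; exact: measurable_velocity.
Qed.

Lemma mpred_well_posed : mpred (fun w => well_posed (b ^~ w)).
Proof.
apply: (@mpred_iff _ _ (fun w => (forall i, 0 < velocity (b ^~ w) i) /\
  (forall i, 0 < delay (b ^~ w) i) /\
  forall A : nat, exists N : nat, forall n : nat, (N <= n)%N ->
    A%:R <= fire_time (b ^~ w) n)).
  move=> w; split=> [[hv [hd hc]]|[hv hd hc]]; split=> //.
    apply/cvgryPge => A; have [N hN] := hc (Num.truncn A).+1.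
    exists N => // n /= Nn; apply: le_trans (hN n Nn).
    by apply/ltW; rewrite truncnS_gt.
  split=> // A; have /cvgryPge /(_ A%:R) [N _ hN] := hc.
  by exists N => n Nn; exact: hN.
apply: mpred_and; last apply: mpred_and.
- by apply: mpred_forall => i; apply: mpred_lt => //; exact: measurable_velocity.
- by apply: mpred_forall => i; apply: mpred_lt => //; exact: measurable_delay.
- apply: mpred_forall => A; apply: mpred_exists => N; apply: mpred_forall => n.
  by apply: mpred_imp => _; apply: mpred_le => //; exact: measurable_fire_time.
Qed.

Lemma collidesP (c : nat -> R * R) (act : nat -> R -> Prop) i s : well_posed c ->
  collides c act i s <-> exists j, i <> j /\ velocity c i != velocity c j /\
    s = meet_time c i j /\ act i s /\ act j s.
Proof.
move=> wp; split=> -[j].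
  move=> [/nesym ij ai aj e]; have vij := meet_velocity wp ij e.
  by exists j; split=> //; split=> //; split=> //; apply/meet_timeP.
move=> [ij [vij [e [ai aj]]]]; exists j; split=> //; first exact/nesym.
exact/meet_timeP.
Qed.

Let wp w := well_posed (b ^~ w).

(** Activity at uncountably many times is never needed: a collision of i and j
    can only take place at the random time [meet_time i j]. *)
Lemma mpred_meets (act : T -> nat -> R -> Prop) i j :
  (forall i tau, measurable_fun setT tau ->
    mpred (fun w => wp w /\ act w i (tau w))) ->
  mpred (fun w => wp w /\ velocity (b ^~ w) i != velocity (b ^~ w) j /\
    act w i (meet_time (b ^~ w) i j) /\ act w j (meet_time (b ^~ w) i j)).
Proof.
move=> mact; have mi := mact i _ (measurable_meet_time i j).
have mj := mact j _ (measurable_meet_time i j).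
have mv : mpred (fun w => velocity (b ^~ w) i != velocity (b ^~ w) j).
  by apply: mpred_neq; exact: measurable_velocity.
apply: mpred_iff (mpred_and mv (mpred_and mi mj)) => w.
by split=> [[? [[? ?] [? ?]]]|[? [? [? ?]]]].
Qed.

(** The random time tau has to be arbitrary for the induction on n to go
    through, because level n is evaluated at the times [meet_time i j]. *)
Lemma mpred_stage n i (tau : T -> R) : measurable_fun setT tau ->
  mpred (fun w => wp w /\ stage (b ^~ w) n i (tau w)).
Proof.
elim: n i tau => [|n IH] i tau mtau /=.
  apply: mpred_and; first exact: mpred_well_posed.
  by apply: mpred_le => //; exact: measurable_fire_time.
pose meets j w := wp w /\ velocity (b ^~ w) i != velocity (b ^~ w) j /\
  stage (b ^~ w) n i (meet_time (b ^~ w) i j) /\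
  stage (b ^~ w) n j (meet_time (b ^~ w) i j).
apply: (@mpred_iff _ _ (fun w => wp w /\ fire_time (b ^~ w) i <= tau w /\
  forall j, i <> j -> ~ (meet_time (b ^~ w) i j < tau w /\ meets j w))).
  move=> w; split=> [[wpw [it nc]]|[wpw [it nc]]]; split=> //; split=> //.
    move=> s st /(collidesP _ _ _ wpw)[j [ij [vij [e [ai aj]]]]].
    by apply: (nc j ij); rewrite -e; split=> //; rewrite /meets -e.
  move=> j ij [st [_ [vij [ai aj]]]]; apply: (nc _ st).
  by apply/(collidesP _ _ _ wpw); exists j.
apply: mpred_and; first exact: mpred_well_posed.
apply: mpred_and; first by apply: mpred_le => //; exact: measurable_fire_time.
apply: mpred_forall => j; apply: mpred_imp => _; apply: mpredN.
apply: mpred_and; first by apply: mpred_lt => //; exact: measurable_meet_time.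
exact: (@mpred_meets (fun w => stage (b ^~ w) n)).
Qed.

Lemma mpred_active i (tau : T -> R) : measurable_fun setT tau ->
  mpred (fun w => wp w /\ active (b ^~ w) i (tau w)).
Proof.
move=> mtau; apply: (@mpred_iff _ _ (fun w => exists N, forall n, (N <= n)%N ->
  wp w /\ stage (b ^~ w) n i (tau w))).
  move=> w; split=> [[N hN]|[wpw ai]].
    have [wpw _] := hN N (leqnn N); split=> //.
    pose n := maxn N (rank (b ^~ w) (tau w)).+1.
    apply/(@stage_active _ _ wpw _ n); first by rewrite leq_max leqnn orbT.
    by apply: (hN n _).2; rewrite leq_maxl.
  by exists (rank (b ^~ w) (tau w)).+1 => n rn; split=> //; apply/stage_active.
apply: mpred_exists => N; apply: mpred_forall => n; apply: mpred_imp => _.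
exact: mpred_stage.
Qed.

Lemma mpred_annihilated i : mpred (fun w => annihilated (b ^~ w) i).
Proof.
apply: (@mpred_iff _ _ (fun w => exists j, i <> j /\ wp w /\
    velocity (b ^~ w) i != velocity (b ^~ w) j /\
    active (b ^~ w) i (meet_time (b ^~ w) i j) /\
    active (b ^~ w) j (meet_time (b ^~ w) i j))).
  move=> w; split=> [[j [ij [wpw [vij [ai aj]]]]]|[t c]].
    exists (meet_time (b ^~ w) i j); apply/collidesP => //.
    by exists j.
  have wpw : wp w by case: c => j [_ []].
  have /(collidesP _ _ _ wpw)[j [ij [vij [e [ai aj]]]]] := c.
  by exists j; rewrite -e.
apply: mpred_exists => j; apply: mpred_and; first exact: mpred_const.
by apply: (@mpred_meets (fun w => active (b ^~ w))) => *; exact: mpred_active.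
Qed.

Lemma infinite_natP (A : set nat) :
  infinite_set A <-> forall N, exists i, (N <= i)%N /\ A i.
Proof.
split=> [infA N|h finA].
  apply: contrapT => /forallNP nA; apply: infA.
  apply: (@sub_finite_set _ _ `I_N) (finite_II N) => i Ai /=.
  by rewrite ltnNge; apply/negP => Ni; apply: (nA i).
have [i [iN]] := h (\max_(i <- fset_set A) i).+1.
move=> Ai; have iA : i \in fset_set A by rewrite in_fset_set // inE.
by move: iN; rewrite ltnNge (leq_bigmax_seq _ iA).
Qed.

(** Stated for measurable maps on any measurable space, so that it also applies
    when the space carries only the sigma-algebra generated by a tail of the
    sequence. *)
Lemma measurable_infinite_survivors :
  measurable [set w | infinite_set (survivors (b ^~ w))].
Proof.
apply: (@mpred_iff _ _ (fun w => forall N, exists i, (N <= i)%N /\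
  ~ annihilated (b ^~ w) i)).
  by move=> w; rewrite infinite_natP.
apply: mpred_forall => N; apply: mpred_exists => i; apply: mpred_and.
  exact: mpred_const.
by apply: mpredN; exact: mpred_annihilated.
Qed.

End Measurability.

(** * A zero-one law *)

Section Independence.
Context d (T : measurableType d) (R : realType) (P : probability T R).
Local Open Scope ereal_scope.

(** The sets independent of A form a lambda-system, so independence passes from
    a pi-system to the sigma-algebra that it generates. *)
Lemma independent_sigma (A : set T) (G : set (set T)) :
  measurable A -> G `<=` measurable -> setI_closed G ->
  (forall B, G B -> P (A `&` B) = P A * P B) ->
  forall B, <<s G>> B -> P (A `&` B) = P A * P B.
Proof.
move=> mA Gm GI indep B sB.
suff : [set C | measurable C /\ P (A `&` C) = P A * P C] B by case.
apply: (lambda_system_subset GI (D := setT) _ _ _ sB) => //; last first.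
  by move=> C GC; split; [exact: Gm|exact: indep].
apply/dynkin_lambda_system; split.
- by split; [exact: measurableT|rewrite setIT probability_setT mule1].
- move=> C [mC e]; split; first exact: measurableC.
  have fA : P A \is a fin_num by exact: fin_num_measure.
  have fC : P C \is a fin_num by exact: fin_num_measure.
  have dI : P A = P (A `&` ~` C) + P (A `&` C).
    by rewrite -setDE; exact: measureDI.
  rewrite probability_setC // muleBr // ?mule1 ?fin_num_adde_defl //.
  by rewrite [X in X - _]dI e addeK // fin_numM.
- move=> F tF hF; split; first by apply: bigcup_measurable => k _; case: (hF k).
  rewrite setI_bigcupr !measure_bigcup //.
  + rewrite -[P A in RHS]fineK ?fin_num_measure // -nneseriesZl //.
    by apply: eq_eseriesr => k _; rewrite fineK ?fin_num_measure //; case: (hF k).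
  + by move=> k _; case: (hF k).
  + by move=> k _; apply: measurableI => //; case: (hF k).
  + exact: trivIset_setIl.
Qed.

Lemma ae_eq_probability (A E F : set T) :
  measurable A -> measurable E -> measurable F ->
  {ae P, forall w, E w <-> F w} -> P (A `&` E) = P (A `&` F).
Proof.
move=> mA mE mF /= ae.
have half (E' F' : set T) : measurable E' -> measurable F' ->
    {ae P, forall w, E' w <-> F' w} -> P (A `&` E') = P (A `&` E' `&` F').
  move=> mE' mF' ae'.
  have dI : P (A `&` E') = P ((A `&` E') `\` F') + P (A `&` E' `&` F').
    by apply: measureDI => //; exact: measurableI.
  rewrite dI [X in X + _](_ : _ = 0) ?add0e //.
  apply: measure_negligible.
    by apply: measurableD => //; exact: measurableI.
  by apply: negligibleS ae' => w /= [[_ Ew] nFw] EF; apply: nFw; apply/EF.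
rewrite (half E F) // (half F E) //; first by rewrite setIAC.
by apply: filterS ae => w EF; apply: iff_sym.
Qed.

End Independence.

Section ZeroOne.
Context d (T : measurableType d) d' (U : measurableType d').
Context (R : realType) (P : probability T R) (X : nat -> {RV P >-> U}).
Local Open Scope ereal_scope.

(** The pi-system of finite-dimensional events that involve coordinates in K
    only. *)
Definition cylinders (K : set nat) : set (set T) :=
  [set B | exists (J : {fset nat}) (C : nat -> set U),
    [/\ forall i, measurable (C i), [set` J] `<=` K &
        B = \bigcap_(i in [set` J]) X i @^-1` C i]].

Lemma cylinders_measurable K : cylinders K `<=` measurable.
Proof.
move=> _ [J [C [mC _ ->]]]; apply: fin_bigcap_measurable => // i _.
by rewrite -[_ @^-1` _]setTI; exact: measurable_funPT.
Qed.

Lemma cylinders_setI K : setI_closed (cylinders K).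
Proof.
move=> _ _ [J1 [C1 [mC1 J1K ->]]] [J2 [C2 [mC2 J2K ->]]].
pose C i := (if i \in J1 then C1 i else setT) `&`
            (if i \in J2 then C2 i else setT).
exists (J1 `|` J2)%fset, C; split.
- by move=> i; apply: measurableI; case: ifP.
- by move=> i /=; rewrite in_fsetU => /orP[/J1K|/J2K].
- apply/seteqP; split=> w /=.
    move=> [h1 h2] i _; split; case: ifPn => // iJ; [exact: h1|exact: h2].
  move=> h; split=> i /= iJ.
    by have [] := h i; rewrite /= ?in_fsetU ?iJ.
  by have [] := h i; rewrite /= ?in_fsetU ?iJ ?orbT.
Qed.

Lemma cylinders_preimage (K : set nat) i C : K i -> measurable C ->
  cylinders K (X i @^-1` C).
Proof.
move=> Ki mC; exists [fset i]%fset, (fun=> C); split=> //.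
  by move=> j /=; rewrite in_fset1 => /eqP ->.
apply/seteqP; split=> w /= h; last by apply: (h i); rewrite /= in_fset1.
by move=> j /=; rewrite in_fset1 => /eqP ->.
Qed.

Hypothesis indep : independent_seq X.

Lemma independent_cylinders (K K' : set nat) A B : K `&` K' = set0 ->
  cylinders K A -> cylinders K' B -> P (A `&` B) = P A * P B.
Proof.
move=> KK' [J1 [C1 [mC1 J1K ->]]] [J2 [C2 [mC2 J2K ->]]].
have disj i : i \in J2 -> i \in J1 = false.
  move=> iJ2; apply/negP => iJ1.
  by have : (K `&` K') i by [split; [exact: J1K|exact: J2K]]; rewrite KK'.
pose C i := if i \in J1 then C1 i else C2 i.
have -> : \bigcap_(i in [set` J1]) X i @^-1` C1 i `&`
    \bigcap_(i in [set` J2]) X i @^-1` C2 i =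
    \bigcap_(i in [set` (J1 `|` J2)%fset]) X i @^-1` C i.
  apply/seteqP; split=> w /=.
    move=> [h1 h2] i /=; rewrite in_fsetU /C; case: ifPn => [iJ _|_ /= iJ];
      [exact: h1|exact: h2].
  move=> h; split=> i /= iJ; have := h i; rewrite /= in_fsetU iJ ?orbT /C.
    by move=> /(_ isT); rewrite iJ.
  by move=> /(_ isT); rewrite disj.
rewrite !indep //; last by move=> i; rewrite /C; case: ifP.
rewrite (big_fsetID _ (mem J1)) /=; congr (_ * _).
- rewrite (_ : [fset _ | _ in _ & _]%fset = J1).
    by apply: eq_big_seq => i iJ; rewrite /C iJ.
  by apply/fsetP => i; rewrite !inE /=; case: (i \in J1); rewrite ?andbF.
- rewrite (_ : [fset _ | _ in _ & _]%fset = J2).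
    by apply: eq_big_seq => i iJ; rewrite /C disj.
  apply/fsetP => i; rewrite !inE /=; have := @disj i.
  by case: (i \in J1); case: (i \in J2) => // /(_ isT).
Qed.

(** A variant of Kolmogorov's law: E 0 need not be a tail event, only almost
    surely equal to an event of each tail.  An event on finitely many
    coordinates is independent of E n for n large, hence of E 0; so E 0 is
    independent of everything, in particular of itself. *)
Lemma zero_one_law (E : nat -> set T) :
  (forall n, <<s cylinders [set i | (n <= i)%N]>> (E n)) ->
  (forall n, {ae P, forall w, E n w <-> E n.+1 w}) ->
  P (E 0%N) = 0 \/ P (E 0%N) = 1.
Proof.
move=> tailE aeE.
have mE n : measurable (E n).
  apply: (smallest_sub _ (@cylinders_measurable [set i | (n <= i)%N]) (tailE n)).
  exact: sigma_algebra_measurable.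
have ae0 n : {ae P, forall w, E 0%N w <-> E n w}.
  elim: n => [|n IH]; first by apply: aeW.
  by apply: filterS2 IH (aeE n) => w ->.
have indepE A : cylinders setT A -> P (A `&` E 0%N) = P A * P (E 0%N).
  move=> cA; have mA := cylinders_measurable cA.
  have [J [C [mC _ AE]]] := cA.
  pose n := (\max_(i <- J) i).+1.
  have cAn : cylinders [set i | (i < n)%N] A.
    by exists J, C; split=> // i iJ; rewrite /= ltnS (leq_bigmax_seq _ iJ).
  rewrite (ae_eq_probability mA (mE 0%N) (mE n) (ae0 n)).
  have -> : P (E 0%N) = P (E n).
    rewrite -[E 0%N]setTI -[E n in RHS]setTI.
    exact: (ae_eq_probability measurableT).
  apply: independent_sigma (tailE n) => //.
  - exact: cylinders_measurable.
  - exact: cylinders_setI.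
  - move=> B; apply: independent_cylinders cAn.
    by apply/seteqP; split=> i //= [] /leq_trans h /h; rewrite ltnn.
have : P (E 0%N `&` E 0%N) = P (E 0%N) * P (E 0%N).
  apply: (independent_sigma (G := cylinders setT)) => //.
  - exact: cylinders_measurable.
  - exact: cylinders_setI.
  - by move=> A cA; rewrite setIC indepE // muleC.
  - apply: (sub_smallest2r _ _ (tailE 0%N)).
      exact: smallest_sigma_algebra.
    by move=> A [J [C [mC _ ->]]]; exists J, C.
rewrite setIid; have fE : P (E 0%N) \is a fin_num by exact: fin_num_measure.
rewrite -[P _]fineK // -EFinM => -[] /eqP; set x := fine _.
by rewrite -[X in X == _]mulr1 -subr_eq0 -mulrBr mulf_eq0 subr_eq0
  => /orP[/eqP ->|/eqP <-]; [left|right].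
Qed.

End ZeroOne.

(** * Independent bullets *)

Section IID.
Context (R : realType) (mu nu : probability R R).
Context (d : measure_display) (T : measurableType d) (P : probability T R).
Implicit Types b : nat -> {RV P >-> (R * R)%type}.

Lemma iid_bullets_drop_first b : iid_bullets mu nu b ->
  iid_bullets mu nu (fun i => b i.+1).
Proof.
move=> [indep law]; split; last by move=> i; exact: law.
move=> J B mB; have := indep (succn @` J)%fset (fun i => B i.-1) (fun i => mB _).
rewrite big_imfset /=; last by move=> ? ? _ _ [].
move=> <-; congr (P _); apply/seteqP; split=> w /= h i /=.
  by move=> /imfsetP[j /= jJ ->]; exact: h.
by move=> iJ; apply: (h i.+1); rewrite /= in_imfset.
Qed.

Hypothesis mu_pos : mu [set x | 0 < x] = 1%E.
Hypothesis nu_pos : nu [set x | 0 < x] = 1%E.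

Lemma ae_bullet_pos b i : iid_bullets mu nu b ->
  {ae P, forall w, 0 < (b i w).1 /\ 0 < (b i w).2}.
Proof.
move=> [_ law]; pose A : set (R * R) := [set x | 0 < x] `*` [set x | 0 < x].
have mpos : measurable [set x : R | 0 < x] by rewrite -set_itvoy.
have mA : measurable A by exact: measurableX.
have mbA : measurable (b i @^-1` A).
  by rewrite -[_ @^-1` _]setTI; exact: measurable_funPT.
have PbA : P (b i @^-1` A) = 1%E.
  apply: etrans (law i A mA) _; apply: etrans (product_measure1E _ _ mpos mpos) _.
  by rewrite -[RHS]mule1; congr (_ * _)%E.
apply/negligibleP; first exact: measurableC mbA.
by apply: etrans (probability_setC P mbA) _; rewrite PbA subee.
Qed.

Hypothesis mu_nu_valid : valid_pair mu nu.

Lemma ae_infinite_survivors_drop_first b : iid_bullets mu nu b ->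
  {ae P, forall w, infinite_set (survivors (b ^~ w)) <->
                   infinite_set (survivors (drop_first (b ^~ w)))}.
Proof.
move=> iid; have pos := ae_bullet_pos 0 iid; have nt := mu_nu_valid iid.
have nt' := mu_nu_valid (iid_bullets_drop_first iid).
by apply: filterS3 pos nt nt' => w [v0 d0] ? ?; exact: infinite_survivors_drop_first.
Qed.

End IID.

Theorem corollary16 (R : realType) (mu nu : probability R R)
  (mu_pos : mu [set x | 0 < x] = 1%E) (nu_pos : nu [set x | 0 < x] = 1%E)
  (mu_nu_valid : valid_pair mu nu)
  (d : measure_display) (T : measurableType d) (P : probability T R)
  (b : nat -> {RV P >-> (R * R)%type}) (b_iid : iid_bullets mu nu b) :
  measurable [set w : T | infinite_set (survivors (b ^~ w))] /\
  (P [set w : T | infinite_set (survivors (b ^~ w))] = 0%E \/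
   P [set w : T | infinite_set (survivors (b ^~ w))] = 1%E).
Proof.
split; first by apply: measurable_infinite_survivors => i; exact: measurable_funPT.
pose tail n i := b (n + i)%N.
pose E n := [set w : T | infinite_set (survivors (tail n ^~ w))].
have tail_iid n : iid_bullets mu nu (tail n).
  elim: n => [//|n /iid_bullets_drop_first].
  by rewrite /tail; under eq_fun do rewrite addnS.
apply: (zero_one_law (proj1 b_iid) (E := E)) => n; last first.
  have := ae_infinite_survivors_drop_first mu_pos nu_pos mu_nu_valid (tail_iid n).
  apply: filterS => w.
  rewrite /E /= (_ : drop_first _ = tail n.+1 ^~ w) //.
  by apply/funext => i; rewrite /drop_first /tail addnS.
pose G := cylinders b [set i | (n <= i)%N].
(* Measurability for the sigma-algebra of the bullets of index at least n. *)
apply: (@measurable_infinite_survivors _ (g_sigma_algebraType G) R (tail n)).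
move=> i _ C mC.
rewrite setTI; apply: sub_sigma_algebra; apply: cylinders_preimage mC.
by rewrite /= leq_addr.
Qed.
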